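(* Let $a,b$ be relatively prime integers such that the Lucas sequences below are non-degenerate, and suppose $a>0$ and $\Delta=a^2+4b>0$. Let $m,n\geq 3$ be integers, $d=\gcd(m,n)$. Then: (i) $\tau(U_mV_n)=2[m,n]$ if $\nu_2(m)\leq \nu_2(n)$, and $\tau(U_mV_n)=[m,n]V_d$ if $\nu_2(m)>\nu_2(n)$. (ii) $\tau(U_mU_n)=[m,n]U_d$. (iii) $\tau(V_mV_n)=[m,n]\gcd(V_m,V_n)$ if ($2\nmid b$, $2\mid a$, $2\mid d$) or ($2\nmid b$, $2\nmid a$, $3\mid d$) or ($2\nmid b$, $2\mid a$, $2\nmid d$, $\nu_2(m)\neq\nu_2(n)$); and $\tau(V_mV_n)=2[m,n]\gcd(V_m,V_n)$ if $2\mid b$ or ($2\nmid b$, $2\nmid a$, $3\nmid d$) or ($2\nmid b$, $2\mid a$, $2\nmid d$, $\nu_2(m)=\nu_2(n)$).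
   Context: For relatively prime integers $a,b$, the first and second Lucas sequences are defined by $U_0=0$, $U_1=1$, $U_{n+2}=aU_{n+1}+bU_n$ and $V_0=2$, $V_1=a$, $V_{n+2}=aV_{n+1}+bV_n$ ($n\ge 0$). Non-degenerate means $b\neq 0$ and $\alpha/\beta$ is not a root of unity, where $\alpha,\beta$ are the roots of $x^2-ax-b=0$. For a positive integer $k$ with $\gcd(k,b)=1$, $\tau(k)$ (the order of appearance) is the smallest positive integer $t$ with $k\mid U_t$. $[m,n]$ denotes the least common multiple and $\nu_p$ the $p$-adic valuation. *)

(* Defs.v *)
From HB Require Import structures.
From mathcomp Require Import all_boot all_order all_algebra all_field.
From mathcomp Require Import boolp.

Set Implicit Arguments.
Unset Strict Implicit.
Unset Printing Implicit Defensive.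

Import Order.TTheory GRing.Theory Num.Theory.
Local Open Scope ring_scope.

Fixpoint lucasU (a b : int) (n : nat) : int :=
  match n with
  | 0%N => 0
  | S p => match p with
           | 0%N => 1
           | S q => a * lucasU a b p + b * lucasU a b q
           end
  end.

Fixpoint lucasV (a b : int) (n : nat) : int :=
  match n with
  | 0%N => 2
  | S p => match p with
           | 0%N => a
           | S q => a * lucasV a b p + b * lucasV a b q
           end
  end.

(* The roots of x^2 - a x - b (with multiplicity) are taken in [algC]; the guard
   [0 < n] is needed because [0.-unity_root] holds of every element. *)
Definition lucas_nondegenerate (a b : int) : Prop :=
  b != 0 /\
  forall alpha beta : algC,
    'X^2 - (a%:~R)%:P * 'X - (b%:~R)%:P = ('X - alpha%:P) * ('X - beta%:P) ->
    forall n : nat, (0 < n)%N -> ~~ n.-unity_root (alpha / beta).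

(* [tau a b k] is the least t > 0 with k | U_t.  When no such t exists it has the
   dummy value 0; for a, b coprime and k > 0 this means that k is not coprime
   to b. *)
Definition tau (a b k : int) : nat :=
  match pselect (exists t : nat, (0 < t)%N && (k %| lucasU a b t)%Z) with
  | left ex_t => ex_minn ex_t
  | right _ => 0%N
  end.

(* Main.v *)
(** Write [m = d k], [n = d l] with [k], [l] coprime.  Since [U] and [V] grow, a
    product [A * B] of two of the values [U_m], [V_m], [U_n], [V_n] can divide [U_t]
    only if [t] is a multiple of an explicit [L] ([[m, n]] or [2 [m, n]]).  Modulo
    [U_L], the quotient [U_(L s) / U_L] is [s] times a unit.  So, writing
    [g = gcd(A, B)] and [U_L = lcm(A, B) * w], [A * B] divides [U_(L s)] iff [g] divides
    [w s], that is, iff [g / gcd(g, w)] divides [s].  The same congruence, applied to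
    [U_L] over its sub-indices, shows that a common divisor of [g] and [w] divides
    both [k] and [l] (twice these for [A = V_m], [B = V_n]), hence is 1 (divides 2);
    in the last case its value is decided by the parities of [U], [V] and [w].  When
    [k] is odd, [tau(U_m V_n)] is read off directly from [U_(2 L) = U_L V_L]. *)
Require Import Defs.
From mathcomp Require Import all_boot all_order all_algebra all_field.
From mathcomp Require Import boolp ring zify.

Set Implicit Arguments.
Unset Strict Implicit.
Unset Printing Implicit Defensive.

Import Order.TTheory GRing.Theory Num.Theory.
Local Open Scope ring_scope.

(** * Divisibility and gcd tools for naturals and integers *)

Lemma logn2_leq_coprime (d k l : nat) : (0 < d)%N -> (0 < k)%N -> (0 < l)%N ->
  coprime k l -> (logn 2 (d * k) <= logn 2 (d * l))%N = odd k.
Proof.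
move=> d0 k0 l0 kl; rewrite !lognM // leq_add2l.
case: (boolP (odd k)) => ok; first by rewrite lognE dvdn2 ok andbF.
have ol : odd l.
  by have:= @coprime_dvdl 2 k l; rewrite dvdn2 ok coprime2n; apply.
(* With [k] even, [l] is odd and has 2-adic valuation 0, while that of [k] is positive. *)
by rewrite [X in (_ <= X)%N]lognE dvdn2 ol andbF leqn0 -[_ == _]negbK -lt0n
  logn_gt0 mem_primes k0 dvdn2 ok.
Qed.

(** [A * B] divides both [X * A] and [X * B], hence their gcd. This provides the cofactor [w] used
    below. *)
Lemma dvdz_gcd_split (A B X : int) :
  (A %| X)%Z -> (B %| X)%Z -> (A * B %| X * gcdz A B)%Z.
Proof.
move=> AX BX; have : (A * B %| `|X|%:Z * gcdz A B)%Z.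
  by rewrite mulz_gcdr dvdz_gcd [X in (X %| _)%Z && _]mulrC !dvdz_mul.
by rewrite !dvdzE !abszM absz_id.
Qed.

Lemma coprimez_dvd (x y z : int) : coprimez y z -> (x %| y)%Z -> coprimez x z.
Proof. by move=> + h; exact: coprimez_dvdl. Qed.

(** With [g = gcdz A B] and [B = B' * g], cancelling [A * g] leaves [Q = B' * w]. So whatever is
    known about the quotient [X / A] constrains [w]. *)
Lemma cofactor_dvdl (A B X Q w : int) : A * B != 0 ->
  X * gcdz A B = A * B * w -> X = A * Q -> (w %| Q)%Z.
Proof.
move=> AB0 + EX; rewrite {X}EX => E; have /dvdzP[B' EB] := dvdz_gcdr A B.
have [A0 B0] : A != 0 /\ B != 0 by apply/andP; rewrite -negb_or -mulf_eq0.
have g0 : gcdz A B != 0 by rewrite gcdz_eq0 negb_and A0.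
suff -> : Q = B' * w by apply: dvdz_mull.
by apply: (mulIf g0); apply: (mulfI A0); rewrite mulrA E {1}EB; ring.
Qed.

Lemma cofactor_dvdr (A B X Q w : int) : A * B != 0 ->
  X * gcdz A B = A * B * w -> X = B * Q -> (w %| Q)%Z.
Proof. by rewrite gcdzC mulrC; apply: cofactor_dvdl. Qed.

Lemma dvdz_coprime_nat (x c : int) (k l : nat) : coprime k l ->
  (x %| c * k%:Z)%Z -> (x %| c * l%:Z)%Z -> (x %| c)%Z.
Proof.
move=> kl xk xl; have : (x %| gcdz (c * k%:Z) (c * l%:Z))%Z by rewrite dvdz_gcd xk.
rewrite -mulz_gcdr; have -> : gcdz k%:Z l%:Z = 1 by rewrite /gcdz !absz_nat (eqP kl).
by rewrite mulr1 !dvdzE absz_id.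
Qed.

(** [x] divides [x * Q] and [y * Q], hence [gcdz x y * Q]. *)
Lemma dvdz_mul_gcd (x y c Q : int) :
  (x %| y * Q)%Z -> (gcdz x y %| c)%Z -> (x %| c * Q)%Z.
Proof.
move=> xyQ gc; have : (x %| gcdz (x * Q) (y * Q))%Z by rewrite dvdz_gcd xyQ dvdz_mulr.
rewrite -mulz_gcdl => h; apply: dvdz_trans h _.
by rewrite !dvdzE !abszM absz_id in gc *; apply: dvdn_mul.
Qed.

Lemma dvdz_anti (x y : int) : 0 <= x -> 0 <= y -> (x %| y)%Z -> (y %| x)%Z -> x = y.
Proof.
rewrite !dvdzE => x0 y0 xy yx.
suff : `|x|%N = `|y|%N by lia.
by apply/eqP; rewrite eqn_dvd xy.
Qed.

Lemma dvdn_coprime_mul (d k l t : nat) : (0 < d)%N -> coprime k l ->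
  (d * k %| t)%N -> (d * l %| t)%N -> (d * k * l %| t)%N.
Proof.
move=> d0 kl /dvdnP[r ->]; rewrite mulnCA dvdn_pmul2l // Gauss_dvdl 1?coprime_sym //.
by move=> lr; rewrite -mulnA dvdn_mul // mulnC dvdn_mul.
Qed.

Lemma dvdz_add (x y z : int) : (x %| y)%Z -> (x %| z)%Z -> (x %| y + z)%Z.
Proof. exact: rpredD. Qed.

Lemma dvdz_sub (x y z : int) : (x %| y)%Z -> (x %| z)%Z -> (x %| y - z)%Z.
Proof. exact: rpredB. Qed.

Lemma dvdz_addr (x y z : int) : (x %| y)%Z -> (x %| y + z)%Z = (x %| z)%Z.
Proof. exact: rpredDl. Qed.

Lemma dvdz_subl (x y z : int) : (x %| z)%Z -> (x %| y - z)%Z = (x %| y)%Z.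
Proof. exact: rpredBr. Qed.

Lemma dvdz_le (x y : int) : 0 < y -> (x %| y)%Z -> x <= y.
Proof. by rewrite dvdzE => y0 /dvdn_leq; lia. Qed.

Lemma even_mulz (x y : int) : (2 %| x * y)%Z = (2 %| x)%Z || (2 %| y)%Z.
Proof. by rewrite !dvdzE abszM Euclid_dvdM. Qed.

Lemma even_addz (x y : int) : (2 %| x + y)%Z = ((2 %| x)%Z == (2 %| y)%Z).
Proof. lia. Qed.

(** * Identities, divisibility and parity of the two Lucas sequences *)

Section Lucas.
Variables a b : int.
Local Notation U := (lucasU a b).
Local Notation V := (lucasV a b).

Lemma lucasUSS n : U n.+2 = a * U n.+1 + b * U n. Proof. by []. Qed.
Lemma lucasVSS n : V n.+2 = a * V n.+1 + b * V n. Proof. by []. Qed.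

Lemma lucasU_addS m n : U (m + n).+1 = U m.+1 * U n.+1 + b * U m * U n.
Proof.
suff: U (m + n).+1 = U m.+1 * U n.+1 + b * U m * U n /\
  U (m + n).+2 = U m.+2 * U n.+1 + b * U m.+1 * U n by case.
elim: m => [|m [IH1 IH2]]; first by rewrite add0n !lucasUSS /=; split; ring.
by rewrite addSn; split=> //; rewrite lucasUSS IH1 IH2 (lucasUSS m.+1) (lucasUSS m); ring.
Qed.

(** The term [b * U m.-1] of the usual addition formula is written [U m.+1 - a * U m], which also
    makes sense for [m = 0]. *)
Lemma lucasU_add m n : U (m + n) = U m * U n.+1 + U m.+1 * U n - a * U m * U n.
Proof.
case: m => [|m]; first by rewrite add0n /=; ring.
by rewrite addSn lucasU_addS !lucasUSS; ring.
Qed.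

Lemma lucasVE n : V n = 2 * U n.+1 - a * U n.
Proof.
suff: V n = 2 * U n.+1 - a * U n /\ V n.+1 = 2 * U n.+2 - a * U n.+1 by case.
elim: n => [|n [IH1 IH2]]; first by rewrite /=; split; ring.
by split=> //; rewrite lucasVSS IH1 IH2 !lucasUSS; ring.
Qed.

Lemma lucasU_double n : U (n * 2) = U n * V n.
Proof. by rewrite muln2 -addnn lucasU_add lucasVE; ring. Qed.

Lemma lucasV_add m n : V (m + n) = U m * V n.+1 + (U m.+1 - a * U m) * V n.
Proof. by rewrite !lucasVE -addSn !lucasU_add !lucasUSS; ring. Qed.

Lemma lucasU_dvd_mul k s : (U k %| U (k * s))%Z.
Proof.
elim: s => [|s IH]; first by rewrite muln0.
rewrite mulnS lucasU_add; apply: dvdz_sub; last exact: dvdz_mull.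
by apply: dvdz_add; [exact: dvdz_mulr | exact: dvdz_mull].
Qed.

Lemma lucasU_dvd k l : (k %| l)%N -> (U k %| U l)%Z.
Proof. by case/dvdnP=> s ->; rewrite mulnC lucasU_dvd_mul. Qed.

Lemma lucasV_dvd_U n t : (n * 2 %| t)%N -> (V n %| U t)%Z.
Proof. by move/lucasU_dvd; apply: dvdz_trans; rewrite lucasU_double dvdz_mull. Qed.

(** Write [k = 2 j + 1] and expand [V (n * 2 j + n)]: one term contains [U (n * 2 j)], a multiple of
    [V n], and the other contains [V n] itself. *)
Lemma lucasV_dvd_mul n k : odd k -> (V n %| V (n * k))%Z.
Proof.
move=> ok; rewrite -(odd_double_half k) ok addnC mulnDr muln1 lucasV_add.
apply: dvdz_add; last exact: dvdz_mull.
by apply/dvdz_mulr/lucasV_dvd_U; rewrite -muln2 mulnA mulnAC; exact: dvdn_mulr.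
Qed.

Lemma lucasU_even_ab n : (2 %| a)%Z -> ~~ (2 %| b)%Z -> (2 %| U n)%Z = ~~ odd n.
Proof.
move=> ea ob; suff: (2 %| U n)%Z = ~~ odd n /\ (2 %| U n.+1)%Z = odd n by case.
elim: n => [|n [IH1 IH2]]; first by [].
split; first by rewrite IH2 /= negbK.
by rewrite lucasUSS even_addz !even_mulz ea (negbTE ob) IH1.
Qed.

Lemma lucasV_even n : (2 %| V n)%Z = (2 %| a)%Z || (2 %| U n)%Z.
Proof. by rewrite lucasVE even_addz -mulNr !even_mulz rpredN. Qed.

(** Modulo 2 this is the Fibonacci sequence, of period 3; the induction therefore carries three
    consecutive indices. *)
Lemma lucasU_odd_ab n : ~~ (2 %| a)%Z -> ~~ (2 %| b)%Z -> (2 %| U n)%Z = (3 %| n)%N.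
Proof.
move=> oa ob; suff: [/\ (2 %| U n)%Z = (3 %| n)%N, (2 %| U n.+1)%Z = (3 %| n.+1)%N
  & (2 %| U n.+2)%Z = (3 %| n.+2)%N] by case.
elim: n => [|n [IH1 IH2 IH3]]; first by rewrite /= mulr1 mulr0 addr0 (negbTE oa).
split=> //; rewrite lucasUSS even_addz !even_mulz (negbTE oa) (negbTE ob) IH2 IH3 /=.
lia.
Qed.

Lemma lucasU_odd_a_even_b n : ~~ (2 %| a)%Z -> (2 %| b)%Z -> (0 < n)%N -> ~~ (2 %| U n)%Z.
Proof.
move=> oa eb; case: n => // n _; elim: n => [//|n IH].
by rewrite lucasUSS even_addz !even_mulz (negbTE oa) eb (negbTE IH).
Qed.

(** * Common divisors and quotients when [a] and [b] are coprime *)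

Section Coprime.
Hypothesis hab : coprimez a b.

Lemma coprimez_b_lucasU n : coprimez b (U n.+1).
Proof.
elim: n => [|n IH]; first by rewrite /coprimez gcdz1.
rewrite lucasUSS addrC /coprimez mulrC gcdzMDl -/(coprimez _ _) coprimezMr IH.
by rewrite coprimez_sym hab.
Qed.

Lemma coprimez_lucasUS n : coprimez (U n) (U n.+1).
Proof.
elim: n => [|n IH]; first by rewrite /coprimez gcdz1.
rewrite lucasUSS /coprimez gcdzMDl -/(coprimez _ _) coprimezMr.
by rewrite [coprimez _ b]coprimez_sym coprimez_b_lucasU coprimez_sym.
Qed.

(** Bezout gives [k m = l n + g] with [g] the gcd. Modulo [x] the addition formula leaves
    [U (l * n).+1 * U g], whose first factor is coprime to [U (l * n)], hence to [x]. *)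
Lemma dvdz_lucasU_gcd x m n : (x %| U m)%Z -> (x %| U n)%Z -> (x %| U (gcdn m n))%Z.
Proof.
case: m => [|m]; first by rewrite gcd0n.
move=> xm xn; have [k l Ekl _] := egcdnP n (ltn0Sn m).
have xk : (x %| U (l * n + gcdn m.+1 n))%Z.
  by rewrite -Ekl mulnC; apply: dvdz_trans xm (lucasU_dvd_mul _ _).
have xl : (x %| U (l * n))%Z by rewrite mulnC; apply: dvdz_trans xn (lucasU_dvd_mul _ _).
move: xk; set g := gcdn _ _.
have -> : U (l * n + g) = U (l * n) * (U g.+1 - a * U g) + U (l * n).+1 * U g.
  by rewrite lucasU_add; ring.
rewrite (dvdz_addr _ (dvdz_mulr _ xl)) Gauss_dvdzr //.
exact: coprimez_dvd (coprimez_lucasUS _) xl.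
Qed.

Lemma dvdz_lucasUV x n : (x %| U n)%Z -> (x %| V n)%Z -> (x %| 2)%Z.
Proof.
move=> xU; rewrite lucasVE (dvdz_subl _ (dvdz_mull _ xU)) Gauss_dvdzl //.
exact: coprimez_dvd (coprimez_lucasUS _) xU.
Qed.

(* [Q = U (k * s) / U k] is congruent to [s * U k.+1 ^+ s.-1] modulo [U k]. *)
Lemma lucasU_quotient k s : exists2 Q, U (k * s) = U k * Q &
  forall x c, (x %| U k)%Z -> (x %| c * Q)%Z = (x %| c * s%:Z)%Z.
Proof.
(* The extra factor [U k.+1] avoids the exponent [s.-1], and so a special case [s = 0]; being a unit
   modulo every divisor of [U k], it can be cancelled. *)
suff [Q EQ cQ] : exists2 Q, U (k * s) = U k * Q &
    (U k %| Q * U k.+1 - s%:Z * U k.+1 ^+ s)%Z.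
  exists Q => // x c xU.
  have cx : coprimez x (U k.+1) by apply: coprimez_dvd xU; apply: coprimez_lucasUS.
  rewrite -(Gauss_dvdzl _ cx) -(@Gauss_dvdzl x (c * s%:Z) (U k.+1 ^+ s)) ?coprimezXr //.
  rewrite -[c * Q * _](subrK (c * s%:Z * U k.+1 ^+ s)) dvdz_addr //.
  by rewrite -!mulrA -mulrBr dvdz_mull // (dvdz_trans xU).
have US r : (U k %| U (k * r).+1 - U k.+1 ^+ r)%Z.
  elim: r => [|r IH]; first by rewrite muln0 expr0 subrr dvdz0.
  rewrite mulnS lucasU_addS exprS addrAC -mulrBr.
  by apply: dvdz_add; [exact: dvdz_mull | rewrite mulrAC; exact: dvdz_mull].
elim: s => [|s [Q EQ IH]]; first by exists 0; rewrite ?muln0 ?mulr0 // !mul0r subr0 dvdz0.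
exists (U (k * s).+1 + U k.+1 * Q - a * U (k * s)).
  by rewrite mulnS lucasU_add EQ; ring.
have -> : (U (k * s).+1 + U k.+1 * Q - a * U (k * s)) * U k.+1 - s.+1%:Z * U k.+1 ^+ s.+1
  = U k.+1 * (U (k * s).+1 - U k.+1 ^+ s) + U k.+1 * (Q * U k.+1 - s%:Z * U k.+1 ^+ s)
    - a * U k.+1 * U (k * s).
  by rewrite intS exprS; ring.
by apply: dvdz_sub; first apply: dvdz_add; apply: dvdz_mull; rewrite ?lucasU_dvd_mul.
Qed.

(** * Computing the order of appearance *)

Lemma tauE k t : (0 < t)%N -> (forall s, (k %| U s)%Z = (t %| s)%N) -> tau a b k = t.
Proof.
move=> t0 kE; rewrite /tau; case: pselect => [ex|[]]; last by exists t; rewrite t0 kE dvdnn.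
case: ex_minnP => r /andP[r0]; rewrite kE => tr /(_ t).
rewrite t0 kE dvdnn => /(_ isT) rt; apply/eqP.
by rewrite eqn_leq rt dvdn_leq.
Qed.

(** Multiplying by the gcd turns [A * B %| U (L * s)] into [h * e %| w * Q], with
    [Q = U (L * s) / U L]. As [e] is coprime to [w / h] and divides [U L], this says [e %| Q], that
    is, [e %| s]. *)
Lemma tau_mul (A B w h e : int) (L : nat) :
    (0 < L)%N -> A * B != 0 -> 0 <= e ->
    (forall t, (A * B %| U t)%Z -> (L %| t)%N) ->
    U L * gcdz A B = A * B * w -> gcdz (gcdz A B) w = h -> gcdz A B = h * e ->
  (tau a b (A * B))%:Z = L%:Z * e.
Proof.
move=> L0 AB0 e0 ABL EL Eh Eg.
have g0 : gcdz A B != 0 by move: AB0; rewrite mulf_eq0 gcdz_eq0 negb_or negb_and => /andP[->].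
have /andP[h0 en0] : (h != 0) && (e != 0) by rewrite -negb_or -mulf_eq0 -Eg.
have /dvdzP[w' Ew] : (h %| w)%Z by rewrite -Eh dvdz_gcdr.
have cew : coprimez e w'.
  have: gcdz e w' * `|h|%:Z = `|h|%:Z.
    by rewrite mulz_gcdl -Ew mulrC -Eg Eh gez0_abs // -Eh.
  by rewrite -[RHS]mul1r => /mulIf E; apply/eqP/E; lia.
have eU : (e %| U L)%Z.
  have /dvdzP[B' EB] := dvdz_gcdr A B.
  have -> : U L = A * B' * w by apply: (mulIf g0); rewrite EL {1}EB; ring.
  rewrite -mulrA dvdz_mulr // (dvdz_trans _ (dvdz_gcdl A B)) // Eg dvdz_mull //.
suff -> : tau a b (A * B) = (L * `|e|)%N by lia.
apply: tauE => [|t]; first by rewrite muln_gt0 L0 absz_gt0.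
have key s : (A * B %| U (L * s))%Z = (`|e| %| s)%N.
  have [Q -> QE] := lucasU_quotient L s.
  rewrite -(dvdz_mul2r g0) [U L * Q * _]mulrAC EL -[A * B * w * Q]mulrA dvdz_mul2l // Eg Ew.
  rewrite [w' * h]mulrC -[h * w' * Q]mulrA dvdz_mul2l // Gauss_dvdzr //.
  by rewrite -[Q]mul1r QE // mul1r.
apply/idP/idP => [h1|]; last first.
  by case/dvdnP=> s ->; rewrite mulnC -mulnA key dvdn_mulr.
have /dvdnP[s Es] := ABL t h1.
by move: h1; rewrite Es mulnC key dvdn_pmul2l.
Qed.

End Coprime.

(** * Positivity and growth *)

Section Positive.
Hypotheses (a_gt0 : 0 < a) (Delta_gt0 : 0 < a ^+ 2 + 4 * b).

(** Unlike the recurrence, where [b] may be negative, this identity and the next have only positive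
    coefficients, so signs propagate by a joint induction. *)
Lemma lucasUS_double n : 2 * U n.+1 = a * U n + V n.
Proof. by rewrite lucasVE; ring. Qed.

Lemma lucasVS_double n : 2 * V n.+1 = a * V n + (a ^+ 2 + 4 * b) * U n.
Proof. by rewrite !lucasVE lucasUSS; ring. Qed.

Lemma lucasUV_ge0 n : 0 <= U n /\ 0 < V n.
Proof.
elim: n => [//|n [U0 V0]].
have := lucasUS_double n; have := lucasVS_double n.
have : 0 < a * V n by apply: mulr_gt0.
have : 0 <= (a ^+ 2 + 4 * b) * U n by apply: mulr_ge0 => //; apply: ltW.
have : 0 <= a * U n by apply: mulr_ge0 => //; apply: ltW.
lia.
Qed.

Lemma lucasV_gt0 n : 0 < V n. Proof. by case: (lucasUV_ge0 n). Qed.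

Lemma lucasU_gt0 n : (0 < n)%N -> 0 < U n.
Proof.
case: n => // n _; have := lucasUS_double n; case: (lucasUV_ge0 n) => U0 V0.
have : 0 <= a * U n by apply: mulr_ge0 => //; apply: ltW.
lia.
Qed.

Lemma lucasV_subU_double n : 2 * (V n.+1 - U n.+1) =
  (a - 1) * (V n - U n) + (a ^+ 2 + 4 * b - 1) * U n.
Proof. by rewrite mulrBr lucasVS_double lucasUS_double; ring. Qed.

Lemma lucasU_leV n : U n <= V n.
Proof.
elim: n => [//|n IH]; have := lucasV_subU_double n; case: (lucasUV_ge0 n) => U0 _.
have : 0 <= (a - 1) * (V n - U n) by apply: mulr_ge0; lia.
have : 0 <= (a ^+ 2 + 4 * b - 1) * U n by apply: mulr_ge0; lia.
lia.
Qed.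

Lemma lucasU_leS n : U n <= U n.+1.
Proof.
have := lucasUS_double n; have := lucasU_leV n; case: (lucasUV_ge0 n) => U0 _.
have : 0 <= (a - 1) * U n by apply: mulr_ge0; lia.
lia.
Qed.

Lemma lucasU_le m n : (m <= n)%N -> U m <= U n.
Proof. by move/subnK <-; elim: (n - m)%N => //= k IH; apply: le_trans IH (lucasU_leS _). Qed.

Hypothesis b_neq0 : b != 0.

Lemma lucasU_ltV n : (1 < n)%N -> U n < V n.
Proof.
move=> n1; case: (ltP 1 a) => a1.
  elim: n {n1} => [//|n IH]; have := lucasV_subU_double n; case: (lucasUV_ge0 n) => U0 _.
  have : 0 < (a - 1) * (V n - U n) by apply: mulr_gt0; lia.
  have : 0 <= (a ^+ 2 + 4 * b - 1) * U n by apply: mulr_ge0; lia.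
  lia.
(* Here the first summand vanishes and strictness comes from the second: [1 + 4 * b > 0] and
   [b != 0] force [b >= 1]. The bound [1 < n] matters, as [U 1 = V 1] when [a = 1]. *)
have Ea : a = 1 by lia.
case: n n1 => [//|n] n1; have := lucasV_subU_double n.
have : 0 < (a ^+ 2 + 4 * b - 1) * U n.
  apply: mulr_gt0; last exact: lucasU_gt0.
  by move: Delta_gt0 b_neq0; rewrite Ea expr1n; lia.
have : (a - 1) * (V n - U n) = 0 by rewrite Ea subrr mul0r.
lia.
Qed.

Lemma lucasU_ltS n : (1 < n)%N -> U n < U n.+1.
Proof.
move=> n1.
have := lucasUS_double n; have := lucasU_ltV n1; case: (lucasUV_ge0 n) => U0 _.
have : 0 <= (a - 1) * U n by apply: mulr_ge0; lia.
lia.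
Qed.

(** * Recovering indices from divisibility *)

Hypothesis hab : coprimez a b.

(** [U m] divides [U g] for [g = gcdn m t]; if [g < m], then [U g <= U m.-1 < U m], which is absurd.
    Strict growth may start only at index 2, whence [2 < m]. *)
Lemma lucasU_dvd_index m t : (2 < m)%N -> (U m %| U t)%Z -> (m %| t)%N.
Proof.
case: m => // m m2 /(dvdz_lucasU_gcd hab (dvdzz (U m.+1))).
set g := gcdn _ t => Ug; have g0 : (0 < g)%N by rewrite gcdn_gt0.
have gm : (g <= m.+1)%N by rewrite dvdn_leq ?dvdn_gcdl.
move: gm; rewrite leq_eqVlt => /orP[/eqP <-|gm]; first exact: dvdn_gcdr.
have Ug0 := lucasU_gt0 g0.
have := dvdz_le Ug0 Ug; have := lucasU_le (gm : (g <= m)%N); have := lucasU_ltS m2; lia.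
Qed.

(** Since [V n] divides [U (n * 2)], it divides [U g] for [g = gcdn (n * 2) t]. A proper divisor [g]
    of [n * 2] is at most [n], and then [U g <= U n < V n]. *)
Lemma lucasV_dvd_index n t : (1 < n)%N -> (V n %| U t)%Z -> (n * 2 %| t)%N.
Proof.
move=> n1; have n20 : (0 < n * 2)%N by lia.
have V0 := lucasV_gt0 n.
move/(dvdz_lucasU_gcd hab (lucasV_dvd_U (dvdnn _))).
set g := gcdn _ t => Ug; have g0 : (0 < g)%N by rewrite gcdn_gt0 n20.
have Ug0 := lucasU_gt0 g0.
have /dvdnP[[|[|k]] Eg] : (g %| n * 2)%N by apply: dvdn_gcdl.
- by move: n20; rewrite Eg.
- by rewrite Eg mul1n dvdn_gcdr.
have gn : (g <= n)%N by nia.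
have := lucasU_le gn; have := lucasU_ltV n1.
have := dvdz_le Ug0 Ug; lia.
Qed.

(** * Products with at least one factor from [U] *)

Lemma tau_lucasUU d k l : (2 < d * k)%N -> (2 < d * l)%N -> coprime k l ->
  (tau a b (U (d * k) * U (d * l)))%:Z = (d * k * l)%:Z * U d.
Proof.
move=> dk dl kl.
have A0 : 0 < U (d * k) by rewrite lucasU_gt0; lia.
have B0 : 0 < U (d * l) by rewrite lucasU_gt0; lia.
have Ud0 : 0 < U d by rewrite lucasU_gt0; lia.
have AB0 : U (d * k) * U (d * l) != 0 by rewrite mulf_neq0 ?gt_eqF.
have Eg : gcdz (U (d * k)) (U (d * l)) = U d.
  apply: dvdz_anti; rewrite // ?(ltW Ud0) //.
    have := dvdz_lucasU_gcd hab (dvdz_gcdl (U (d * k)) (U (d * l))) (dvdz_gcdr _ _).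
    by rewrite -muln_gcdr (eqP kl) muln1.
  by rewrite dvdz_gcd !lucasU_dvd_mul.
have [Q EQ QE] := lucasU_quotient hab (d * k) l.
have [Q' EQ' QE'] := lucasU_quotient hab (d * l) k.
rewrite mulnAC in EQ'.
have /dvdzP[w Ew] : (U (d * k) * U (d * l) %|
    U (d * k * l) * gcdz (U (d * k)) (U (d * l)))%Z.
  by apply: dvdz_gcd_split; [rewrite EQ | rewrite EQ']; apply: dvdz_mulr.
rewrite [w * _]mulrC in Ew.
apply: (tau_mul hab _ AB0 _ _ Ew (h := 1)); rewrite ?mul1r ?(ltW Ud0) //; first by nia.
  move=> t h; apply: dvdn_coprime_mul => //; first by nia.
    by apply: lucasU_dvd_index => //; apply: dvdz_trans h; apply: dvdz_mulr.
  by apply: lucasU_dvd_index => //; apply: dvdz_trans h; apply: dvdz_mull.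
(* [w] divides [Q] and [Q'], which modulo [x] are [l] and [k] up to units; so [x] divides both and
   is 1. *)
rewrite Eg; set x := gcdz _ w.
have xU r : (x %| U (d * r))%Z by rewrite (dvdz_trans (dvdz_gcdl _ _)) ?lucasU_dvd_mul.
have xw : (x %| w)%Z by apply: dvdz_gcdr.
apply: dvdz_anti => //; rewrite ?dvd1z //.
apply: (dvdz_coprime_nat kl).
  by rewrite -QE' // mul1r; apply: dvdz_trans xw (cofactor_dvdr AB0 Ew EQ').
by rewrite -QE // mul1r; apply: dvdz_trans xw (cofactor_dvdl AB0 Ew EQ).
Qed.

(** As [k] is odd, [V (d * l)] divides [V (d * k * l)], so the product divides [U] at
    [d * k * l * 2]. Conversely [d * k] and [d * l * 2] must divide the index, and [k] is coprime to
    [l * 2]. *)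
Lemma tau_lucasUV_odd d k l : (2 < d * k)%N -> (1 < d * l)%N -> coprime k l -> odd k ->
  tau a b (U (d * k) * V (d * l)) = (d * k * l * 2)%N.
Proof.
move=> dk dl kl ok; apply: tauE => [|s]; first by nia.
apply/idP/idP => [h|]; last first.
  move/lucasU_dvd; apply: dvdz_trans.
  rewrite lucasU_double dvdz_mul ?lucasU_dvd_mul //.
  by rewrite mulnAC lucasV_dvd_mul.
rewrite -mulnA dvdn_coprime_mul //; first by nia.
- by rewrite coprimeMr kl coprimen2.
- by apply: lucasU_dvd_index => //; apply: dvdz_trans h; apply: dvdz_mulr.
- by rewrite mulnA; apply: lucasV_dvd_index => //; apply: dvdz_trans h; apply: dvdz_mull.
Qed.

(** The gcd [G] divides [U (d * 2) = U d * V d] and is a multiple [h * V d]. Then [h] divides [U d]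
    and [V (d * l) / V d], which forces [h] to divide both 2 and the odd number [l]. *)
Lemma gcdz_lucasUV d k l : (0 < d)%N -> coprime k l -> ~~ odd k ->
  gcdz (U (d * k)) (V (d * l)) = V d.
Proof.
move=> d0 kl ek.
have ol : odd l by have:= @coprime_dvdl 2 k l; rewrite dvdn2 ek coprime2n; apply.
have Ek : k = (2 * k./2)%N by rewrite mul2n even_halfK.
have Vd0 := lucasV_gt0 d; have Vd_neq0 : V d != 0 by rewrite gt_eqF.
apply: dvdz_anti; rewrite // ?(ltW Vd0) //; last first.
  rewrite dvdz_gcd lucasV_dvd_mul // andbT lucasV_dvd_U //.
  by rewrite {1}Ek mulnA dvdn_mulr.
set G := gcdz _ _.
have GA : (G %| U (d * k))%Z by apply: dvdz_gcdl.
have GB : (G %| V (d * l))%Z by apply: dvdz_gcdr.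
have /dvdzP[h Eh] : (V d %| G)%Z.
  rewrite dvdz_gcd lucasV_dvd_mul // andbT lucasV_dvd_U //.
  by rewrite {1}Ek mulnA dvdn_mulr.
have GU2 : (G %| U (d * 2))%Z.
  have -> : (d * 2 = gcdn (d * k) (d * l * 2))%N.
    rewrite -mulnA -muln_gcdr; congr (_ * _)%N.
    by rewrite Gauss_gcdr // [in RHS]Ek -[X in gcdn _ X]muln1 -muln_gcdr gcdn1 muln1.
  apply: dvdz_lucasU_gcd => //; apply: dvdz_trans GB _.
  by rewrite lucasU_double dvdz_mull.
have hU : (h %| U d)%Z by move: GU2; rewrite lucasU_double Eh dvdz_mul2r.
have /dvdzP[y Ey] := lucasV_dvd_mul d ol.
have /dvdzP[u Eu] := lucasU_dvd_mul d l.
have hy : (h %| y)%Z by move: GB; rewrite Ey Eh dvdz_mul2r.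
have [Q EQ QE] := lucasU_quotient hab (d * 2) l.
have EQuy : Q = u * y.
  have U20 : U (d * 2) != 0 by rewrite gt_eqF // lucasU_gt0 // muln_gt0 d0.
  by apply: (mulfI U20); rewrite -EQ mulnAC !lucasU_double Ey Eu; ring.
have hl : (h %| 1 * l%:Z)%Z.
  rewrite -QE; first by rewrite EQuy mulrA dvdz_mull.
  by rewrite lucasU_double dvdz_mulr.
have h2 : (h %| 1 * 2%:Z)%Z.
  rewrite mul1r (dvdz_lucasUV hab (n := d * l)) ?Ey ?dvdz_mulr //.
  by rewrite Eu dvdz_mull.
have h1 := dvdz_coprime_nat _ hl h2.
by rewrite Eh -[X in (_ %| X)%Z]mul1r dvdz_mul // h1 // coprimen2.
Qed.

Lemma tau_lucasUV_even d k l : (2 < d * k)%N -> (1 < d * l)%N -> coprime k l -> ~~ odd k ->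
  (tau a b (U (d * k) * V (d * l)))%:Z = (d * k * l)%:Z * V d.
Proof.
move=> dk dl kl ek; have d0 : (0 < d)%N by lia.
have ol : odd l by have:= @coprime_dvdl 2 k l; rewrite dvdn2 ek coprime2n; apply.
have Ek : k = (2 * k./2)%N by rewrite mul2n even_halfK.
have A0 : 0 < U (d * k) by rewrite lucasU_gt0; lia.
have B0 := lucasV_gt0 (d * l); have Vd0 := lucasV_gt0 d.
have AB0 : U (d * k) * V (d * l) != 0 by rewrite mulf_neq0 ?gt_eqF.
have Eg := gcdz_lucasUV d0 kl ek.
have [Q EQ QE] := lucasU_quotient hab (d * k) l.
have [Q' EQ' QE'] := lucasU_quotient hab (d * l * 2) k./2.
have {}EQ' : U (d * k * l) = V (d * l) * (U (d * l) * Q').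
  by rewrite mulrA [V _ * _]mulrC -lucasU_double -EQ' -[(_ * 2 * _)%N]mulnA -Ek mulnAC.
have /dvdzP[w Ew] : (U (d * k) * V (d * l) %|
    U (d * k * l) * gcdz (U (d * k)) (V (d * l)))%Z.
  by apply: dvdz_gcd_split; [rewrite EQ | rewrite EQ']; apply: dvdz_mulr.
rewrite [w * _]mulrC in Ew.
apply: (tau_mul hab _ AB0 _ _ Ew (h := 1)); rewrite ?mul1r ?(ltW Vd0) //; first by nia.
  move=> t h; apply: dvdn_coprime_mul => //.
    by apply: lucasU_dvd_index => //; apply: dvdz_trans h; apply: dvdz_mulr.
  (* The factor 2 in [d * l * 2] may be dropped: [k] is even, so [d * k * l] is already a multiple
     of it. *)
  apply: (dvdn_trans (dvdn_mulr 2 (dvdnn _))).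
  by apply: lucasV_dvd_index => //; apply: dvdz_trans h; apply: dvdz_mull.
rewrite Eg; set x := gcdz _ w.
have xV : (x %| V d)%Z by apply: dvdz_gcdl.
have xA : (x %| U (d * k))%Z by apply: dvdz_trans xV _; rewrite -Eg dvdz_gcdl.
have xB : (x %| V (d * l))%Z by apply: dvdz_trans xV _; rewrite -Eg dvdz_gcdr.
have xw : (x %| w)%Z by apply: dvdz_gcdr.
apply: dvdz_anti => //; rewrite ?dvd1z //.
have xl : (x %| 1 * l%:Z)%Z.
  by rewrite -QE // mul1r; apply: dvdz_trans xw (cofactor_dvdl AB0 Ew EQ).
apply: (dvdz_coprime_nat kl) => //.
rewrite {1}Ek PoszM mulrCA dvdz_mull //.
rewrite -QE'; last by rewrite lucasU_double dvdz_mull.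
(* The factor [U (d * l)] is coprime to [x]: a common divisor divides 2, since [x] divides
   [V (d * l)], and also the odd [l]. *)
apply: (@dvdz_mul_gcd _ (U (d * l))).
  by apply: dvdz_trans xw (cofactor_dvdr AB0 Ew EQ').
apply: (@dvdz_coprime_nat _ _ 2 l); first by rewrite coprime2n.
  rewrite mul1r (dvdz_lucasUV hab (dvdz_gcdr _ _)) //.
  by apply: dvdz_trans (dvdz_gcdl _ _) xB.
by apply: dvdz_trans (dvdz_gcdl _ _) xl.
Qed.

(** * Products of two values of [V] *)

Section LucasVV.
Variables d k l : nat.
Hypotheses (dk : (1 < d * k)%N) (dl : (1 < d * l)%N) (kl : coprime k l).
Let A := V (d * k).
Let B := V (d * l).

Lemma tau_lucasVV w : U (d * k * l * 2) * gcdz A B = A * B * w ->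
  (tau a b (A * B))%:Z = if (2 %| gcdz (gcdz A B) w)%Z then (d * k * l)%:Z * gcdz A B
                         else 2 * (d * k * l)%:Z * gcdz A B.
Proof.
have k0 : (0 < k)%N by case: (posnP k) dk => // ->; rewrite muln0.
have l0 : (0 < l)%N by case: (posnP l) dl => // ->; rewrite muln0.
have d0 : (0 < d)%N by case: (posnP d) dk => // ->.
move=> Ew.
have A0 : 0 < A by apply: lucasV_gt0.
have B0 : 0 < B by apply: lucasV_gt0.
have AB0 : A * B != 0 by rewrite mulf_neq0 ?gt_eqF.
have [Q EQ QE] := lucasU_quotient hab (d * k * 2) l.
have [Q' EQ' QE'] := lucasU_quotient hab (d * l * 2) k.
have {}EQ : U (d * k * l * 2) = A * (U (d * k) * Q).
  by rewrite mulrA [A * _]mulrC -lucasU_double -EQ mulnAC.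
have {}EQ' : U (d * k * l * 2) = B * (U (d * l) * Q').
  by rewrite mulrA [B * _]mulrC -lucasU_double -EQ' [in RHS]mulnAC [(d * l * k)%N]mulnAC.
set h := gcdz (gcdz A B) w.
have hA : (h %| A)%Z by apply: dvdz_trans (dvdz_gcdl _ _) (dvdz_gcdl _ _).
have hB : (h %| B)%Z by apply: dvdz_trans (dvdz_gcdl _ _) (dvdz_gcdr _ _).
have hw : (h %| w)%Z by apply: dvdz_gcdr.
(* [w] divides [U (d * k) * Q] with [Q] equal to [l] up to a unit modulo [h], and
   [gcdz h (U (d * k))] divides 2 because [h] divides [V (d * k)]. So [h] divides [2 * l], and
   likewise [2 * k]. *)
have h2 : (h %| 2)%Z.
  apply: (dvdz_coprime_nat kl).
    rewrite -QE'; last by rewrite lucasU_double dvdz_mull.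
    apply: (@dvdz_mul_gcd _ (U (d * l))).
      by apply: dvdz_trans hw (cofactor_dvdr AB0 Ew EQ').
    by apply: (dvdz_lucasUV hab (dvdz_gcdr _ _)); apply: dvdz_trans (dvdz_gcdl _ _) hB.
  rewrite -QE; last by rewrite lucasU_double dvdz_mull.
  apply: (@dvdz_mul_gcd _ (U (d * k))).
    by apply: dvdz_trans hw (cofactor_dvdl AB0 Ew EQ).
  by apply: (dvdz_lucasUV hab (dvdz_gcdr _ _)); apply: dvdz_trans (dvdz_gcdl _ _) hA.
have /dvdzP[e Ee] : (h %| gcdz A B)%Z by apply: dvdz_gcdl.
have hE : h = if (2 %| h)%Z then 2 else 1.
  have : 0 <= h by [].
  by case: h h2 {hA hB hw Ee} => // -[|[|[|n]]] //= /dvdz_le/(_ isT).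
have h0 : 0 < h by rewrite hE; case: ifP.
have e0 : 0 <= e by rewrite -(pmulr_lge0 _ h0) -Ee.
have -> : (tau a b (A * B))%:Z = (d * k * l * 2)%N%:Z * e.
  apply: (tau_mul hab _ AB0 e0 _ Ew (h := h)) => //; last by rewrite mulrC.
    by rewrite !muln_gt0 d0 k0 l0.
  move=> t hh; rewrite -!mulnA [(l * 2)%N]mulnC [(k * _)%N]mulnCA 2!mulnA.
  apply: dvdn_coprime_mul => //; first by rewrite muln_gt0 d0.
    by rewrite mulnAC; apply: lucasV_dvd_index => //; apply: dvdz_trans hh; apply: dvdz_mulr.
  by rewrite mulnAC; apply: lucasV_dvd_index => //; apply: dvdz_trans hh; apply: dvdz_mull.
by move: hE; case: ifP => _ hE; rewrite Ee hE PoszM; ring.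
Qed.

(** Both [A] and [B] divide [V (d * k * l)], so [A * B] already divides [V (d * k * l) * gcdz A B];
    the factor [U (d * k * l)] is left to [w]. *)
Lemma lucasVV_cofactor_odd w : odd k -> odd l ->
  U (d * k * l * 2) * gcdz A B = A * B * w -> (U (d * k * l) %| w)%Z.
Proof.
move=> ok ol Ew.
have A0 : A != 0 by rewrite gt_eqF // lucasV_gt0.
have B0 : B != 0 by rewrite gt_eqF // lucasV_gt0.
have /dvdzP[v Ev] : (A * B %| V (d * k * l) * gcdz A B)%Z.
  by apply: dvdz_gcd_split; [|rewrite mulnAC]; apply: lucasV_dvd_mul.
apply/dvdzP; exists v; apply: (mulfI (mulf_neq0 A0 B0)).
by rewrite -Ew lucasU_double -mulrA Ev; ring.
Qed.

(** If [k] is even, [B] divides [U (d * k * l)] and [A] divides [V (d * k * l)]; the roles swap if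
    [l] is even. So [A * B] divides [U (d * k * l * 2)] itself. *)
Lemma lucasVV_cofactor_even w : ~~ (odd k && odd l) ->
  U (d * k * l * 2) * gcdz A B = A * B * w -> (gcdz A B %| w)%Z.
Proof.
move=> ekl Ew.
have A0 : A != 0 by rewrite gt_eqF // lucasV_gt0.
have B0 : B != 0 by rewrite gt_eqF // lucasV_gt0.
have AB0 := mulf_neq0 A0 B0.
suff /dvdzP[q Eq] : (A * B %| U (d * k * l * 2))%Z.
  by apply/dvdzP; exists q; apply: (mulfI AB0); rewrite -Ew Eq; ring.
rewrite lucasU_double; move: ekl; rewrite negb_and => /orP[ek|el].
  have ol : odd l by have:= @coprime_dvdl 2 k l; rewrite dvdn2 ek coprime2n; apply.
  rewrite mulrC dvdz_mul ?lucasV_dvd_mul // lucasV_dvd_U //.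
  by rewrite [(d * k * l)%N]mulnAC dvdn_mul // dvdn2.
have ok : odd k by have:= @coprime_dvdr 2 l k; rewrite dvdn2 el coprimen2; apply.
apply: dvdz_mul; first by rewrite lucasV_dvd_U // dvdn_mul // dvdn2.
by rewrite mulnAC lucasV_dvd_mul.
Qed.

(** [w] divides [U (d * k) * Q]. The first factor is odd, and [Q] has the parity of [l] because
    [U (d * k * 2)] is even. *)
Lemma lucasVV_cofactor_not_even w : (2 %| a)%Z -> ~~ (2 %| b)%Z -> odd (d * k) -> odd l ->
  U (d * k * l * 2) * gcdz A B = A * B * w -> ~~ (2 %| w)%Z.
Proof.
move=> ea ob odk ol Ew; apply/negP => w2.
have AB0 : A * B != 0 by rewrite mulf_neq0 ?gt_eqF ?lucasV_gt0.
have [Q EQ QE] := lucasU_quotient hab (d * k * 2) l.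
have {}EQ : U (d * k * l * 2) = A * (U (d * k) * Q).
  by rewrite mulrA [A * _]mulrC -lucasU_double -EQ mulnAC.
have := dvdz_trans w2 (cofactor_dvdl AB0 Ew EQ).
rewrite even_mulz lucasU_even_ab // odk /= -[Q]mul1r QE; first by rewrite mul1r dvdzE dvdn2 ol.
by rewrite lucasU_even_ab // oddM andbF.
Qed.

End LucasVV.

End Positive.
End Lucas.

Theorem theorem1p1 (a b : int) (hab : coprimez a b) (hnd : lucas_nondegenerate a b)
    (ha : 0 < a) (hDelta : 0 < a ^+ 2 + 4 * b)
    (m n d : nat) (hm : (3 <= m)%N) (hn : (3 <= n)%N) (hd : d = gcdn m n) :
  [/\ (* (i) *)
      ((logn 2 m <= logn 2 n)%N ->
         (tau a b (lucasU a b m * lucasV a b n))%:Z = 2 * (lcmn m n)%:Z) /\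
      ((logn 2 n < logn 2 m)%N ->
         (tau a b (lucasU a b m * lucasV a b n))%:Z
         = (lcmn m n)%:Z * lucasV a b d),
      (* (ii) *)
      (tau a b (lucasU a b m * lucasU a b n))%:Z
      = (lcmn m n)%:Z * lucasU a b d
    & (* (iii) *)
      ([\/ [/\ ~~ (2 %| b)%Z, (2 %| a)%Z & (2 %| d)%N],
           [/\ ~~ (2 %| b)%Z, ~~ (2 %| a)%Z & (3 %| d)%N]
         | [/\ ~~ (2 %| b)%Z, (2 %| a)%Z, ~~ (2 %| d)%N
             & logn 2 m <> logn 2 n]] ->
         (tau a b (lucasV a b m * lucasV a b n))%:Z
         = (lcmn m n)%:Z * gcdz (lucasV a b m) (lucasV a b n)) /\
      ([\/ (2 %| b)%Z,
           [/\ ~~ (2 %| b)%Z, ~~ (2 %| a)%Z & ~~ (3 %| d)%N]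
         | [/\ ~~ (2 %| b)%Z, (2 %| a)%Z, ~~ (2 %| d)%N
             & logn 2 m = logn 2 n]] ->
         (tau a b (lucasV a b m * lucasV a b n))%:Z
         = 2 * (lcmn m n)%:Z * gcdz (lucasV a b m) (lucasV a b n)) ].
Proof.
have [b0 _] := hnd.
have d0 : (0 < d)%N by rewrite hd gcdn_gt0; lia.
have /dvdnP[k Em] : (d %| m)%N by rewrite hd dvdn_gcdl.
have /dvdnP[l En] : (d %| n)%N by rewrite hd dvdn_gcdr.
rewrite mulnC in Em; rewrite mulnC in En.
have kl : coprime k l.
  by rewrite /coprime -(eqn_pmul2l d0) muln1 muln_gcdr -Em -En -hd.
have EL : lcmn m n = (d * k * l)%N.
  by apply/eqP; rewrite -(eqn_pmul2r d0) {1}hd muln_lcm_gcd Em En; apply/eqP; ring.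
have [k0 l0] : (0 < k)%N /\ (0 < l)%N by split; lia.
(* From here on the conditions on valuations become parities of [k] and [l]. *)
have mn : (logn 2 m <= logn 2 n)%N = odd k by rewrite Em En logn2_leq_coprime.
have nm : (logn 2 n <= logn 2 m)%N = odd l.
  by rewrite Em En logn2_leq_coprime // coprime_sym.
have mnE : (logn 2 m == logn 2 n) = odd k && odd l by rewrite eqn_leq mn nm.
rewrite ltnNge mn EL {mn nm hnd hd EL}; subst m n.
split.
- split=> ok; first by rewrite tau_lucasUV_odd // ?(ltnW hn) // PoszM mulrC.
  by rewrite tau_lucasUV_even // ltnW.
- exact: tau_lucasUU.
have /dvdzP[w Ew] : (lucasV a b (d * k) * lucasV a b (d * l) %|
    lucasU a b (d * k * l * 2) * gcdz (lucasV a b (d * k)) (lucasV a b (d * l)))%Z.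
  apply: dvdz_gcd_split; apply: lucasV_dvd_U; rewrite dvdn_pmul2r //.
    exact: dvdn_mulr.
  by rewrite (mulnAC d k l) dvdn_mulr.
rewrite [w * _]mulrC in Ew.
rewrite (tau_lucasVV ha hDelta b0 hab (ltnW hm) (ltnW hn) kl Ew) !dvdz_gcd.
have Veven r : ~~ (2 %| a)%Z -> ~~ (2 %| b)%Z -> (2 %| lucasV a b r)%Z = (3 %| r)%N.
  by move=> oa ob; rewrite lucasV_even (negbTE oa) lucasU_odd_ab.
split=> H.
  have g2 : (2 %| lucasV a b (d * k))%Z && (2 %| lucasV a b (d * l))%Z.
    case: H => [[_ ea _]|[ob oa d3]|[_ ea _ _]]; rewrite ?lucasV_even ?ea //.
    by rewrite (negbTE oa) !lucasU_odd_ab // !dvdn_mulr.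
  rewrite g2 /=; suff -> : (2 %| w)%Z by [].
  (* For [k], [l] both odd, [w] is a multiple of [U (d * k * l)], even in the first two
     alternatives; the third is excluded. Otherwise [w] is a multiple of the even gcd. *)
  have [/andP[ok ol]|ekl] := boolP (odd k && odd l); last first.
    apply: dvdz_trans _ (lucasVV_cofactor_even ha hDelta kl ekl Ew).
    by rewrite dvdz_gcd.
  apply: dvdz_trans _ (lucasVV_cofactor_odd ha hDelta ok ol Ew).
  case: H => [[ob ea d2]|[ob oa d3]|[_ _ _ /eqP]]; last by rewrite mnE ok ol.
    by rewrite lucasU_even_ab // -dvdn2 -mulnA dvdn_mulr.
  by rewrite lucasU_odd_ab // -mulnA dvdn_mulr.
have -> // : (2 %| lucasV a b (d * k))%Z && (2 %| lucasV a b (d * l))%Z && (2 %| w)%Z = false.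
(* The odd number is in turn [V (d * k)]; one of the two [V] values, since 3 cannot divide both
   indices; and [w]. *)
apply/negbTE; case: H => [eb|[ob oa d3]|[ob ea od /eqP]].
- have oa : ~~ (2 %| a)%Z.
    apply/negP => ea; have : (2 %| gcdz a b)%Z by rewrite dvdz_gcd ea.
    by rewrite (eqP hab).
  rewrite lucasV_even (negbTE oa) (negbTE (lucasU_odd_a_even_b oa eb _)) //; lia.
- rewrite !Veven //; apply/negP => /andP[/andP[d3k d3l] _].
  have Ed : gcdn (d * k) (d * l) = d by rewrite -muln_gcdr (eqP kl) muln1.
  by move: d3; rewrite -Ed dvdn_gcd d3k d3l.
- rewrite mnE => /andP[ok ol]; rewrite negb_and.
  have odk : odd (d * k) by rewrite oddM ok andbT -[odd d]negbK -dvdn2.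
  by rewrite (lucasVV_cofactor_not_even ha hDelta hab ea ob odk ol Ew) orbT.
Qed.
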